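(* Let $n$ be a positive integer. The group $FH_n$ admits a presentation with generators $y_{k,l}$ for $1\le k\neq l\le n$ and defining relations $$y_{k,l}^2=1,$$ $$y_{i,j}\,y_{k,l}=y_{k,l}\,y_{i,j}\ \Leftrightarrow\ (y_{i,j}\,y_{k,l})^2=1,$$ $$y_{i,k}\,y_{k,j}\,y_{i,k}=y_{k,j}\,y_{i,k}\,y_{k,j}\ \Leftrightarrow\ (y_{i,k}\,y_{k,j})^3=1,$$ where distinct letters stand for distinct indices (and the two forms of each of the last two relations are equivalent in the presence of the first).
   Context: The virtual braid group $VB_n$ is the group with generators $\sigma_1,\dots,\sigma_{n-1},\rho_1,\dots,\rho_{n-1}$ and defining relations: (R1) $\sigma_i\sigma_{i+1}\sigma_i=\sigma_{i+1}\sigma_i\sigma_{i+1}$ for $1\le i\le n-2$; (R2) $\sigma_i\sigma_j=\sigma_j\sigma_i$ for $|i-j|\ge 2$; (R3) $\rho_i\rho_{i+1}\rho_i=\rho_{i+1}\rho_i\rho_{i+1}$ for $1\le i\le n-2$; (R4) $\rho_i\rho_j=\rho_j\rho_i$ for $|i-j|\ge 2$; (R5) $\rho_i^2=1$ for $1\le i\le n-1$; (R6) $\sigma_i\rho_j=\rho_j\sigma_i$ for $|i-j|\ge 2$; (M) $\rho_i\rho_{i+1}\sigma_i=\sigma_{i+1}\rho_i\rho_{i+1}$ for $1\le i\le n-2$. The flat virtual braid group $FVB_n$ is the quotient of $VB_n$ by the relations $\sigma_i^2=1$ for $1\le i\le n-1$; the image of $\sigma_i$ is denoted $s_i$ and the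 image of $\rho_i$ is still denoted $\rho_i$. $FH_n$ is the kernel of the homomorphism $\mu\colon FVB_n\to S_n$ given by $\mu(s_i)=1$, $\mu(\rho_i)=(i,i+1)$ for $1\le i\le n-1$. The elements $y_{k,l}\in FH_n$ are defined as follows. For $1\le i\le n-1$: $y_{i,i+1}=s_i$ and $y_{i+1,i}=\rho_is_i\rho_i$. For $1\le i<j-1\le n-1$: $y_{i,j}=\rho_{j-1}\cdots\rho_{i+1}\,s_i\,\rho_{i+1}\cdots\rho_{j-1}$ and $y_{j,i}=\rho_{j-1}\cdots\rho_{i+1}\,\rho_is_i\rho_i\,\rho_{i+1}\cdots\rho_{j-1}$. *)

(* Defs.v *)
From HB Require Import structures.
From mathcomp Require Import all_boot all_fingroup.
From mathcomp Require Import boolp.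

Set Implicit Arguments.
Unset Strict Implicit.
Unset Printing Implicit Defensive.

Local Open Scope group_scope.
Local Open Scope quotient_scope.

(* Group words over X: the letter (x, false) stands for x and (x, true) for
   its formal inverse; the product of words is concatenation.  Words are not
   reduced: cancellation is part of pres_eq below. *)
Definition word (X : Type) := seq (X * bool).

Definition letter (X : Type) (x : X) : word X := [:: (x, false)].

Definition word_inv (X : Type) (w : word X) : word X :=
  rev [seq (a.1, ~~ a.2) | a <- w].

Definition word_eval (X : Type) (G : groupType) (f : X -> G) (w : word X) : G :=
  \prod_(a <- w) (if a.2 then (f a.1)^-1 else f a.1).

(* A family of relations; R u v stands for the relation u = v. *)
Definition relations (X : Type) := word X -> word X -> Prop.

Inductive pres_eq (X : Type) (R : relations X) : relations X :=
| pres_eq_refl w : pres_eq R w w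
| pres_eq_sym u v : pres_eq R u v -> pres_eq R v u
| pres_eq_trans u v w : pres_eq R u v -> pres_eq R v w -> pres_eq R u w
| pres_eq_cat u u' v v' :
    pres_eq R u u' -> pres_eq R v v' -> pres_eq R (u ++ v) (u' ++ v')
| pres_eq_cancel x b : pres_eq R [:: (x, b); (x, ~~ b)] [::]
| pres_eq_rel u v : R u v -> pres_eq R u v.

Section PresentedGroup.
Variables (X : choiceType) (R : relations X).

Definition pres_eqb : rel (word X) := fun u v => `[< pres_eq R u v >].

Lemma pres_eqb_refl : reflexive pres_eqb.
Proof. by move=> w; apply/asboolP; apply: pres_eq_refl. Qed.

Lemma pres_eqb_sym : symmetric pres_eqb.
Proof. by move=> u v; apply/asboolP/asboolP; apply: pres_eq_sym. Qed.

Lemma pres_eqb_trans : transitive pres_eqb.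
Proof.
move=> v u w /asboolP uv /asboolP vw; apply/asboolP.
exact: pres_eq_trans uv vw.
Qed.

Canonical pres_equiv :=
  EquivRel pres_eqb pres_eqb_refl pres_eqb_sym pres_eqb_trans.

(* The group < X | R > *)
Definition presented : Type := {eq_quot pres_equiv}.

HB.instance Definition _ := Choice.on presented.
HB.instance Definition _ := EqQuotient.on presented.

Definition pres_class (w : word X) : presented := \pi_presented w.
Definition pres_repr (x : presented) : word X := generic_quotient.repr x.

Lemma pres_classP u v : pres_class u = pres_class v <-> pres_eq R u v.
Proof. by split=> [/eqquotP/asboolP|uv] //; apply/eqquotP/asboolP. Qed.

Lemma pres_classK (x : presented) : pres_class (pres_repr x) = x.
Proof. exact: reprK. Qed.

Lemma word_invK : involutive (@word_inv X).
Proof.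
move=> w; rewrite /word_inv map_rev revK -map_comp -[RHS]map_id.
by apply: eq_map => -[x b] /=; rewrite negbK.
Qed.

Lemma word_inv_cons a (w : word X) :
  word_inv (a :: w) = word_inv w ++ [:: (a.1, ~~ a.2)].
Proof. by rewrite /word_inv /= rev_cons cats1. Qed.

Lemma word_inv_cat (u v : word X) : word_inv (u ++ v) = word_inv v ++ word_inv u.
Proof. by rewrite /word_inv map_cat rev_cat. Qed.

Lemma pres_eq_wordV (w : word X) : pres_eq R (w ++ word_inv w) [::].
Proof.
elim: w => [|[x b] w IH]; first exact: pres_eq_refl.
have -> : ((x, b) :: w) ++ word_inv ((x, b) :: w)
    = [:: (x, b)] ++ ((w ++ word_inv w) ++ [:: (x, ~~ b)]).
  by rewrite word_inv_cons -catA.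
apply: (@pres_eq_trans _ _ _ ([:: (x, b)] ++ ([::] ++ [:: (x, ~~ b)]))); last first.
  exact: pres_eq_cancel.
apply: pres_eq_cat; first exact: pres_eq_refl.
by apply: pres_eq_cat => //; apply: pres_eq_refl.
Qed.

Lemma pres_eq_inv u v : pres_eq R u v -> pres_eq R (word_inv u) (word_inv v).
Proof.
move=> uv; apply: (@pres_eq_trans _ _ _ (word_inv u ++ (v ++ word_inv v))).
  rewrite -[X in pres_eq R X _]cats0; apply: pres_eq_cat.
    exact: pres_eq_refl.
  exact/pres_eq_sym/pres_eq_wordV.
rewrite catA -[X in pres_eq R _ X]cat0s.
apply: pres_eq_cat; last exact: pres_eq_refl.
apply: (@pres_eq_trans _ _ _ (word_inv u ++ u)).
  by apply: pres_eq_cat; [exact: pres_eq_refl|exact: pres_eq_sym].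
by rewrite -{2}[u]word_invK; exact: pres_eq_wordV.
Qed.

Definition pres_one : presented := pres_class [::].
Definition pres_mul (x y : presented) : presented :=
  pres_class (pres_repr x ++ pres_repr y).
Definition pres_inv (x : presented) : presented :=
  pres_class (word_inv (pres_repr x)).

Lemma pres_reprP w : pres_eq R (pres_repr (pres_class w)) w.
Proof. by apply/pres_classP; rewrite pres_classK. Qed.

Lemma pres_mulE u v : pres_mul (pres_class u) (pres_class v) = pres_class (u ++ v).
Proof. by apply/pres_classP/pres_eq_cat; apply: pres_reprP. Qed.

Lemma pres_invE u : pres_inv (pres_class u) = pres_class (word_inv u).
Proof. by apply/pres_classP/pres_eq_inv/pres_reprP. Qed.

Lemma pres_mulA : associative pres_mul.
Proof.
move=> x y z; rewrite -[x]pres_classK -[y]pres_classK -[z]pres_classK.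
by rewrite !pres_mulE catA.
Qed.

Lemma pres_mul1 : left_id pres_one pres_mul.
Proof. by move=> x; rewrite -[x]pres_classK pres_mulE. Qed.

Lemma pres_mulr1 : right_id pres_one pres_mul.
Proof. by move=> x; rewrite -[x]pres_classK pres_mulE cats0. Qed.

Lemma pres_mulrV : right_inverse pres_one pres_inv pres_mul.
Proof.
move=> x; rewrite -[x]pres_classK pres_invE pres_mulE.
exact/pres_classP/pres_eq_wordV.
Qed.

Lemma pres_mulVr : left_inverse pres_one pres_inv pres_mul.
Proof.
move=> x; rewrite -[x]pres_classK pres_invE pres_mulE.
apply/pres_classP; rewrite -{2}[pres_repr x]word_invK; exact: pres_eq_wordV.
Qed.

HB.instance Definition _ :=
  isGroup.Build presented pres_mulA pres_mul1 pres_mulr1 pres_mulVr pres_mulrV.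

Definition pres_gen (x : X) : presented := pres_class (letter x).

Lemma pres_class_cat u v : pres_class (u ++ v) = pres_class u * pres_class v.
Proof. by rewrite -pres_mulE. Qed.

End PresentedGroup.

(* The homomorphism < X | R > -> G induced by f : X -> G. *)
Section Lift.
Variables (X : choiceType) (R : relations X) (G : groupType) (f : X -> G).

Lemma word_eval_cat u v : word_eval f (u ++ v) = word_eval f u * word_eval f v.
Proof. by rewrite /word_eval big_cat. Qed.

Lemma word_eval_letter x : word_eval f (letter x) = f x.
Proof. by rewrite /word_eval /letter big_seq1. Qed.

Hypothesis fR : forall u v, R u v -> word_eval f u = word_eval f v.

Lemma word_eval_pres u v : pres_eq R u v -> word_eval f u = word_eval f v.
Proof.
elim=> {u v} //; first by move=> u v w _ -> _ ->.
  by move=> u u' v v' _ uu' _ vv'; rewrite !word_eval_cat uu' vv'.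
by move=> x [] /=;
  rewrite /word_eval !big_cons big_nil /= mulg1 ?mulVg ?mulgV.
Qed.

Definition pres_lift (x : presented R) : G := word_eval f (pres_repr x).

Lemma pres_lift_class w : pres_lift (pres_class R w) = word_eval f w.
Proof. exact/word_eval_pres/pres_reprP. Qed.

Lemma pres_lift_gen x : pres_lift (pres_gen R x) = f x.
Proof. by rewrite pres_lift_class word_eval_letter. Qed.

Lemma pres_liftM : {morph pres_lift : x y / x * y}.
Proof.
move=> x y; rewrite -[x]pres_classK -[y]pres_classK -pres_class_cat.
by rewrite !pres_lift_class word_eval_cat.
Qed.

Lemma pres_lift1 : pres_lift 1 = 1.
Proof. by rewrite pres_lift_class /word_eval big_nil. Qed.

End Lift.

(* G has the presentation < X | R >, x in X standing for f x in G. *)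
Definition has_presentation (X : choiceType) (G : groupType) (f : X -> G)
    (R : relations X) : Prop :=
  exists phi : {multiplicative (presented R) -> G},
    bijective phi /\ forall x, phi (pres_gen R x) = f x.

(* Indices are 0-based: 'I_n.-1 indexes the generators, so that i : 'I_n.-1
   stands for the usual index i + 1, and the strands are 0, ..., n - 1. *)
Definition VB_gen (n : nat) : choiceType := ('I_n.-1 + 'I_n.-1)%type.
Definition sigmaw n (i : 'I_n.-1) : word (VB_gen n) := letter (inl i).
Definition rhow n (i : 'I_n.-1) : word (VB_gen n) := letter (inr i).

(* |i - j| >= 2 *)
Definition far (i j : nat) : bool := (i.+1 < j)%N || (j.+1 < i)%N.

Inductive VB_rel (n : nat) : relations (VB_gen n) :=
| VB_R1 (i j : 'I_n.-1) : j = i.+1 :> nat ->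
    VB_rel (sigmaw i ++ sigmaw j ++ sigmaw i) (sigmaw j ++ sigmaw i ++ sigmaw j)
| VB_R2 (i j : 'I_n.-1) : far i j ->
    VB_rel (sigmaw i ++ sigmaw j) (sigmaw j ++ sigmaw i)
| VB_R3 (i j : 'I_n.-1) : j = i.+1 :> nat ->
    VB_rel (rhow i ++ rhow j ++ rhow i) (rhow j ++ rhow i ++ rhow j)
| VB_R4 (i j : 'I_n.-1) : far i j ->
    VB_rel (rhow i ++ rhow j) (rhow j ++ rhow i)
| VB_R5 (i : 'I_n.-1) : VB_rel (rhow i ++ rhow i) [::]
| VB_R6 (i j : 'I_n.-1) : far i j ->
    VB_rel (sigmaw i ++ rhow j) (rhow j ++ sigmaw i)
| VB_M (i j : 'I_n.-1) : j = i.+1 :> nat ->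
    VB_rel (rhow i ++ rhow j ++ sigmaw i) (sigmaw j ++ rhow i ++ rhow j).

(* Quotienting VB_n by sigma_i^2 = 1 amounts to adding these relations. *)
Inductive FVB_rel (n : nat) : relations (VB_gen n) :=
| FVB_VB u v : VB_rel u v -> FVB_rel u v
| FVB_sq (i : 'I_n.-1) : FVB_rel (sigmaw i ++ sigmaw i) [::].

Definition VB (n : nat) : groupType := presented (@VB_rel n).
Definition FVB (n : nat) : groupType := presented (@FVB_rel n).

(* Generators of FVB n with a natural number as index; the value 1 for
   i >= n.-1 is junk. *)
Definition s n (i : nat) : FVB n :=
  if insub i is Some j then pres_gen (@FVB_rel n) (inl j) else 1.
Definition rho n (i : nat) : FVB n :=
  if insub i is Some j then pres_gen (@FVB_rel n) (inr j) else 1.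

Lemma strand_proof n (i : 'I_n.-1) : (i < n)%N.
Proof. by case: n i => [|n] [i] //= /ltnW. Qed.
Lemma next_strand_proof n (i : 'I_n.-1) : (i.+1 < n)%N.
Proof. by case: n i => [|n] [i]. Qed.

(* The product of 'S_n in MathComp composes from left to right.  As the images
   of the generators are involutions, the opposite convention only composes mu
   with inversion, and the kernel is the same. *)
Definition adj_tperm n (i : 'I_n.-1) : 'S_n :=
  tperm (Ordinal (strand_proof i)) (Ordinal (next_strand_proof i)).

Definition mu_gen n (x : VB_gen n) : 'S_n :=
  match x with inl _ => 1 | inr i => adj_tperm i end.

Lemma mu_gen_rel n (u v : word (VB_gen n)) :
  FVB_rel u v -> word_eval (@mu_gen n) u = word_eval (@mu_gen n) v.
Proof.
have E0 : word_eval (@mu_gen n) [::] = 1 by rewrite /word_eval big_nil.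
have braid (i j : 'I_n.-1) : j = i.+1 :> nat ->
    adj_tperm i * (adj_tperm j * adj_tperm i)
    = adj_tperm j * (adj_tperm i * adj_tperm j).
  move=> ij.
  have e : Ordinal (next_strand_proof i) = Ordinal (strand_proof j).
    by apply: val_inj; rewrite /= ij.
  rewrite /adj_tperm e.
  set a := Ordinal (strand_proof i); set b := Ordinal (strand_proof j).
  set c := Ordinal (next_strand_proof j).
  have ab : a != b by rewrite -val_eqE /= ij neq_ltn ltnSn.
  have ac : a != c by rewrite -val_eqE /= ij neq_ltn ltnS leqnSn.
  have bc : b != c by rewrite -val_eqE /= neq_ltn ltnSn.
  have conj x y z t : tperm x y * (tperm z t * tperm x y)
      = tperm z t ^ tperm x y :> 'S_n by rewrite /conjg tpermV.
  rewrite !conj !tpermJ tpermR tpermL [tperm a b c]tpermD //.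
  by rewrite [tperm b c a]tpermD // eq_sym.
have comm (i j : 'I_n.-1) : far i j ->
    adj_tperm i * adj_tperm j = adj_tperm j * adj_tperm i.
  rewrite /far => ij; apply/esym/commgP/conjg_fixP; rewrite tpermJ.
  have ne : [&& i != j :> nat, i.+1 != j & j.+1 != i].
    case/orP: ij => lt; have lt' := ltnW lt.
      by rewrite (ltn_eqF lt') (ltn_eqF lt) (gtn_eqF (ltn_trans lt' (ltnSn _))).
    by rewrite (gtn_eqF lt') (ltn_eqF lt) (gtn_eqF (ltn_trans lt' (ltnSn _))).
  by case/and3P: ne => ? ? ?; rewrite !tpermD // -val_eqE /= ?eqSS // eq_sym.
case=> {u v} [u v|i]; last by rewrite word_eval_cat !word_eval_letter E0 mulg1.
case=> {u v} *; rewrite ?word_eval_cat !word_eval_letter ?E0 /= ?mulg1 ?mul1g //.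
- exact: braid.
- exact: comm.
- exact: tperm2.
Qed.

Definition mu n : FVB n -> 'S_n := pres_lift (@mu_gen n).

HB.instance Definition _ n :=
  isMultiplicative.Build (FVB n) 'S_n (@mu n) (pres_liftM (@mu_gen_rel n)).
HB.instance Definition _ n :=
  Multiplicative_isUMagmaMorphism.Build (FVB n) 'S_n (@mu n)
    (pres_lift1 (@mu_gen_rel n)).

Definition in_ker_mu n : pred (FVB n) := fun x => mu x == 1.

Lemma ker_mu_closed n : group_closed (@in_ker_mu n).
Proof.
split=> [|x y]; rewrite !unfold_in /in_ker_mu ?gmulf1 //.
by move=> /eqP hx /eqP hy; apply/eqP; rewrite gmulfF /= hx hy divg1.
Qed.

Definition FH (n : nat) : Type := {x : FVB n | in_ker_mu x}.

HB.instance Definition _ n := SubChoice.on (FH n).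
HB.instance Definition _ n :=
  SubChoice_isSubGroup.Build (FVB n) (@in_ker_mu n) (FH n) (@ker_mu_closed n).

(* With 0-based strands a < b,
   y_{a,b} = rho_{b-1} ... rho_{a+1} s_a rho_{a+1} ... rho_{b-1},
   y_{b,a} = rho_{b-1} ... rho_{a+1} rho_a s_a rho_a rho_{a+1} ... rho_{b-1};
   for b = a + 1 the outer products are empty. *)
Definition y_conj n (a b : nat) (x : FVB n) : FVB n :=
  (\prod_(m <- rev (index_iota a.+1 b)) rho n m) * x
  * \prod_(m <- index_iota a.+1 b) rho n m.

Definition y_elt n (k l : nat) : FVB n :=
  if (k < l)%N then y_conj k l (s n k)
  else y_conj l k (rho n l * s n l * rho n l).

Lemma mu_s n i : mu (s n i) = 1.
Proof.
rewrite /s; case: insubP => [j _ _|_]; last exact: gmulf1.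
exact: (pres_lift_gen (@mu_gen_rel n)).
Qed.

Lemma mu_rho n (i : 'I_n.-1) : mu (rho n i) = adj_tperm i.
Proof. by rewrite /rho valK; exact: (pres_lift_gen (@mu_gen_rel n)). Qed.

Lemma rho_sq n i : rho n i * rho n i = 1.
Proof.
rewrite /rho; case: insubP => [j _ _|_]; last exact: mulg1.
by rewrite -pres_class_cat; apply/pres_classP/pres_eq_rel/FVB_VB/VB_R5.
Qed.

Lemma rho_conj1 n r :
  (\prod_(m <- rev r) rho n m) * (\prod_(m <- r) rho n m) = 1.
Proof.
elim: r => [|i r IH]; first by rewrite !big_nil mulg1.
rewrite rev_cons -cats1 big_cat big_seq1 big_cons -mulgA.
by rewrite (mulgA (rho n i)) rho_sq mul1g.
Qed.

Lemma y_eltP n k l : in_ker_mu (y_elt n k l).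
Proof.
have E a b x : mu x = 1 -> mu (y_conj a b x) = 1 :> 'S_n.
  by move=> hx; rewrite /y_conj !gmulfM /= hx mulg1 -gmulfM rho_conj1 gmulf1.
rewrite /in_ker_mu /y_elt; case: ifP => _; rewrite E ?mu_s //.
by rewrite !gmulfM /= mu_s mulg1 -gmulfM rho_sq gmulf1.
Qed.

Definition FH_gen (n : nat) : choiceType := {kl : 'I_n * 'I_n | kl.1 != kl.2}.

Definition y n (kl : FH_gen n) : FH n :=
  exist (fun x => in_ker_mu x) (y_elt n (val kl).1 (val kl).2) (y_eltP _ _ _).

Definition yw n (k l : 'I_n) (kl : k != l) : word (FH_gen n) :=
  letter (exist _ (k, l) kl).

Inductive FH_rel (n : nat) : relations (FH_gen n) :=
| FH_sq (k l : 'I_n) (kl : k != l) : FH_rel (yw kl ++ yw kl) [::]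
| FH_comm (i j k l : 'I_n) (ij : i != j) (kl : k != l) :
    uniq [:: i; j; k; l] ->
    FH_rel (yw ij ++ yw kl) (yw kl ++ yw ij)
| FH_braid (i j k : 'I_n) (ik : i != k) (kj : k != j) :
    uniq [:: i; j; k] ->
    FH_rel (yw ik ++ yw kj ++ yw ik) (yw kj ++ yw ik ++ yw kj).

Definition word_exp (X : Type) (w : word X) (m : nat) : word X :=
  flatten (nseq m w).

(* The Coxeter form of the same relations. *)
Inductive FH_cox_rel (n : nat) : relations (FH_gen n) :=
| FH_cox_sq (k l : 'I_n) (kl : k != l) : FH_cox_rel (word_exp (yw kl) 2) [::]
| FH_cox_comm (i j k l : 'I_n) (ij : i != j) (kl : k != l) :
    uniq [:: i; j; k; l] ->
    FH_cox_rel (word_exp (yw ij ++ yw kl) 2) [::]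
| FH_cox_braid (i j k : 'I_n) (ik : i != k) (kj : k != j) :
    uniq [:: i; j; k] ->
    FH_cox_rel (word_exp (yw ik ++ yw kj) 3) [::].

(* Main.v *)
Require Import Defs.
From HB Require Import structures.
From mathcomp Require Import all_boot all_fingroup zify.
Set Implicit Arguments.
Unset Strict Implicit.
Unset Printing Implicit Defensive.
Local Open Scope group_scope.

(* Let A be the abstract group with generators y_{k,l} and the stated relations.
   S_n acts on A by permuting indices, and s_i -> y_{i,i+1}, rho_i -> (i,i+1)
   respects the relations of FVB_n, giving a homomorphism FVB_n -> S_n |x A.
   Conversely rho_i y_{k,l} rho_i = y_{tau_i k, tau_i l} in FVB_n, tau_i being
   the transposition (i,i+1), so every instance of a relation between the
   y_{k,l} is conjugate to one between s_0, s_1, s_2, and A -> FH_n is well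
   defined.  The composite A -> FH_n -> S_n |x A is the inclusion, so A -> FH_n
   is injective.  It is onto because each element of FVB_n is a word in the
   rho_i times an element of the image of A, and a word in the rho_i with
   trivial permutation is trivial, by the Coxeter presentation of S_n. *)

(** * Conjugates of a family along ascending products of involutions *)

Definition adj_swap (i k : nat) : nat :=
  if k == i then i.+1 else if k == i.+1 then i else k.

Lemma adj_swapR i : adj_swap i i.+1 = i.
Proof. by rewrite /adj_swap gtn_eqF // eqxx. Qed.

Lemma adj_swapD i k : k != i -> k != i.+1 -> adj_swap i k = k.
Proof. by rewrite /adj_swap => /negbTE-> /negbTE->. Qed.

Section ConjugateFamily.
Variables (G : groupType) (r x : nat -> G) (N : nat).
Hypothesis r_sq : forall i, r i * r i = 1.
Hypothesis r_far : forall i j, far i j -> commute (r i) (r j).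
Hypothesis r_braid :
  forall i, i.+1 < N -> r i * r i.+1 * r i = r i.+1 * r i * r i.+1.
Hypothesis x_far : forall a i, far a i -> x a ^ r i = x a.
Hypothesis x_adj : forall a, a.+1 < N -> x a.+1 ^ r a = x a ^ r a.+1.

(* For the r_i = rho_i this is y_{a,b} when x_a = s_a and y_{b,a} when
   x_a = rho_a s_a rho_a; both families satisfy the hypotheses above. *)
Definition conj_fam a b := x a ^ \prod_(m <- index_iota a.+1 b) r m.

Lemma conjgKr z i : (z ^ r i) ^ r i = z.
Proof. by rewrite -conjgM r_sq conjg1. Qed.

Lemma conjg_far z i j : far i j -> (z ^ r i) ^ r j = (z ^ r j) ^ r i.
Proof. by move=> /r_far ij; rewrite -!conjgM ij. Qed.

Lemma conj_fam_base a : conj_fam a a.+1 = x a.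
Proof. by rewrite /conj_fam /index_iota subnn big_nil conjg1. Qed.

Lemma conj_famS a b : a < b -> conj_fam a b.+1 = conj_fam a b ^ r b.
Proof. by move=> ab; rewrite /conj_fam big_nat_recr //= conjgM. Qed.

Lemma conj_fam_above a b i :
  a < b -> b < i -> conj_fam a b ^ r i = conj_fam a b.
Proof.
elim: b => // b IH; rewrite ltnS leq_eqVlt => /predU1P[<-|ab] bi.
  by rewrite conj_fam_base x_far // /far bi.
rewrite conj_famS // conjg_far ?IH // /far ?bi //; lia.
Qed.

Lemma conj_fam_below a b i :
  a < b -> i.+1 < a -> conj_fam a b ^ r i = conj_fam a b.
Proof.
elim: b => // b IH; rewrite ltnS leq_eqVlt => /predU1P[<-|ab] ia.
  by rewrite conj_fam_base x_far // /far ia orbT.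
rewrite conj_famS // conjg_far ?IH // /far; lia.
Qed.

(** The base case is [x_adj]. For larger [b] the extra factors are all far from [r i], which
    therefore slides past them. *)
Lemma conj_fam_left b i :
  i.+1 < b -> b <= N -> conj_fam i.+1 b ^ r i = conj_fam i b.
Proof.
elim: b => // b IH; rewrite ltnS leq_eqVlt => /predU1P[<-|ib] bN.
  by rewrite conj_fam_base conj_famS ?leqnn // conj_fam_base x_adj.
rewrite conj_famS // conjg_far ?IH //; [|lia|rewrite /far; lia].
by rewrite -conj_famS //; lia.
Qed.

Lemma conj_fam_between a b i :
  a < i -> i.+1 < b -> b <= N -> conj_fam a b ^ r i = conj_fam a b.
Proof.
move=> ai; elim: b => // b IH; rewrite ltnS leq_eqVlt => /predU1P[<-|ib] bN.
  rewrite !conj_famS //; last lia.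
  (* Here [b] is i+2, so the conjugator ends in r_i r_{i+1}. Multiplying by r_i and applying the
     braid relation brings r_{i+1} to the front, where it fixes [c]. *)
  move: (conj_fam a i) (conj_fam_above ai (ltnSn i)) => c cE.
  by rewrite -!conjgM mulgA r_braid // -mulgA !conjgM cE.
rewrite conj_famS //; last lia.
rewrite conjg_far ?IH // /far; lia.
Qed.

(** The pair (i, i+1) is excluded because r_i reverses its order, which leads out of this family. In
    all other cases the position of [i] relative to [a] and [b] selects one of the preceding
    lemmas. *)
Lemma conj_fam_swap a b i : a < b -> b <= N -> i < N ->
  ~~ ((a == i) && (b == i.+1)) ->
  conj_fam a b ^ r i = conj_fam (adj_swap i a) (adj_swap i b).
Proof.
move=> ab bN iN; rewrite /adj_swap.
case: (eqVneq a i) => [<-|nai] /=.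
  move=> nb; rewrite (negbTE nb) gtn_eqF //.
  by rewrite -(@conj_fam_left b a) ?conjgKr //; lia.
move=> _; case: (eqVneq a i.+1) => [ai|nai'].
  have -> : (b == i) = false by lia.
  have -> : (b == i.+1) = false by lia.
  by rewrite ai conj_fam_left // -ai.
case: (eqVneq b i) => [bi|nbi]; first by rewrite -bi conj_famS.
case: (eqVneq b i.+1) => [bi|nbi'].
  by rewrite bi conj_famS ?conjgKr //; lia.
have [ia|ia] := ltnP i a; first by rewrite conj_fam_below //; lia.
have [ib|ib] := ltnP i b; first by rewrite conj_fam_between //; lia.
by rewrite conj_fam_above //; lia.
Qed.

End ConjugateFamily.

(** * Relations of FVB_n and conjugation of the y_{k,l} by the rho_i *)

Lemma pres_class_rel (X : choiceType) (R : relations X) u v :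
  R u v -> pres_class R u = pres_class R v.
Proof. by move=> uv; apply/pres_classP/pres_eq_rel. Qed.

Section FVB.
Variable n : nat.

Lemma rhoE (i : 'I_n.-1) : rho n i = pres_class (@FVB_rel n) (rhow i).
Proof. by rewrite /rho valK. Qed.

Lemma sE (i : 'I_n.-1) : s n i = pres_class (@FVB_rel n) (sigmaw i).
Proof. by rewrite /s valK. Qed.

Lemma rho_out i : n.-1 <= i -> rho n i = 1.
Proof. by move=> ni; rewrite /rho insubF // ltnNge ni. Qed.

Lemma s_out i : n.-1 <= i -> s n i = 1.
Proof. by move=> ni; rewrite /s insubF // ltnNge ni. Qed.

Lemma rhoV i : (rho n i)^-1 = rho n i.
Proof. exact/mulg1_eq/rho_sq. Qed.

(** Stated for all natural indices, as [conj_fam_swap] requires: an out-of-range generator has the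
    default value 1, which commutes with everything. *)
Lemma rho_far i j : far i j -> commute (rho n i) (rho n j).
Proof.
move=> ij; have [ni|ni] := leqP n.-1 i.
  by rewrite (rho_out ni); exact/commute_sym/commute1.
have [nj|nj] := leqP n.-1 j.
  by rewrite (rho_out nj); exact/commute1.
rewrite -[i]/(val (Ordinal ni)) -[j]/(val (Ordinal nj)) /commute !rhoE.
by rewrite -!pres_class_cat; apply/pres_class_rel/FVB_VB/VB_R4.
Qed.

Lemma s_rho_far i j : far i j -> s n i ^ rho n j = s n i.
Proof.
move=> ij; apply/conjg_fixP/commgP.
have [ni|ni] := leqP n.-1 i.
  by rewrite (s_out ni); exact/commute_sym/commute1.
have [nj|nj] := leqP n.-1 j.
  by rewrite (rho_out nj); exact/commute1.
rewrite -[i]/(val (Ordinal ni)) -[j]/(val (Ordinal nj)) /commute sE rhoE.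
by rewrite -!pres_class_cat; apply/pres_class_rel/FVB_VB/VB_R6.
Qed.

Lemma s_far i j : i < n.-1 -> j < n.-1 -> far i j -> commute (s n i) (s n j).
Proof.
move=> ni nj ij.
rewrite -[i]/(val (Ordinal ni)) -[j]/(val (Ordinal nj)) /commute !sE.
by rewrite -!pres_class_cat; apply/pres_class_rel/FVB_VB/VB_R2.
Qed.

Lemma s_sq i : s n i * s n i = 1.
Proof.
have [ni|ni] := leqP n.-1 i; first by rewrite (s_out ni) mulg1.
rewrite -[i]/(val (Ordinal ni)) sE.
by rewrite -!pres_class_cat; apply/pres_class_rel/FVB_sq.
Qed.

Lemma rho_braid i : i.+1 < n.-1 ->
  rho n i * rho n i.+1 * rho n i = rho n i.+1 * rho n i * rho n i.+1.
Proof.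
move=> nj.
have braid (a b : 'I_n.-1) : b = a.+1 :> nat ->
    rho n a * rho n b * rho n a = rho n b * rho n a * rho n b.
  move=> ab; rewrite !rhoE .
  by have /pres_class_rel := FVB_VB (VB_R3 ab); rewrite !pres_class_cat !mulgA.
exact: (braid (Ordinal (ltnW nj)) (Ordinal nj)).
Qed.

Lemma s_braid i : i.+1 < n.-1 ->
  s n i * s n i.+1 * s n i = s n i.+1 * s n i * s n i.+1.
Proof.
move=> nj.
have braid (a b : 'I_n.-1) : b = a.+1 :> nat ->
    s n a * s n b * s n a = s n b * s n a * s n b.
  move=> ab; rewrite !sE .
  by have /pres_class_rel := FVB_VB (VB_R1 ab); rewrite !pres_class_cat !mulgA.
exact: (braid (Ordinal (ltnW nj)) (Ordinal nj)).
Qed.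

(** The mixed relation (M), rearranged with rho_i^2 = 1 into an equality of two conjugates. *)
Lemma s_rho_adj i : i.+1 < n.-1 -> s n i.+1 ^ rho n i = s n i ^ rho n i.+1.
Proof.
move=> nj.
have mixed (a b : 'I_n.-1) : b = a.+1 :> nat ->
    rho n a * rho n b * s n a = s n b * rho n a * rho n b.
  move=> ab; rewrite !sE !rhoE .
  by have /pres_class_rel := FVB_VB (VB_M ab); rewrite !pres_class_cat !mulgA.
have /= E := mixed (Ordinal (ltnW nj)) (Ordinal nj) erefl.
have {}E : s n i.+1 * rho n i = rho n i * rho n i.+1 * s n i * rho n i.+1.
  by rewrite E -mulgA rho_sq mulg1.
by rewrite !conjgE !rhoV E !mulgA rho_sq mul1g.
Qed.

Lemma y_eltE k l : y_elt n k l =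
  if k < l then conj_fam (rho n) (s n) k l
  else conj_fam (rho n) (fun a => s n a ^ rho n a) l k.
Proof.
have E a b z : y_conj a b z = z ^ \prod_(m <- index_iota a.+1 b) rho n m.
  rewrite /y_conj conjgE -mulgA; congr (_ * _).
  by rewrite -[LHS]invgK (mulg1_eq (rho_conj1 n _)).
rewrite /y_elt !E /conj_fam; case: ifP => // _.
by rewrite [s n l ^ _]conjgE rhoV mulgA.
Qed.

Lemma y_elt_swap i k l : i < n.-1 -> k < n -> l < n -> k != l ->
  y_elt n k l ^ rho n i = y_elt n (adj_swap i k) (adj_swap i l).
Proof.
move=> iN kn ln kl; rewrite !y_eltE.
have sq_i := @rho_sq n.
pose t a := s n a ^ rho n a.
have t_far a j : far a j -> t a ^ rho n j = t a.
  by move=> aj; rewrite /t (conjg_far rho_far) // s_rho_far.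
have t_adj a : a.+1 < n.-1 -> t a.+1 ^ rho n a = t a ^ rho n a.+1.
  (* With everything expressed through s_a, the conjugator on the left is rho_{a+1} rho_a rho_{a+1}
     rho_a, which the braid relation shortens to rho_a rho_{a+1}. *)
  move=> aN; have E : s n a.+1 = s n a ^ (rho n a.+1 * rho n a).
    by rewrite conjgM -s_rho_adj // conjgKr.
  rewrite /t E -!conjgM -!mulgA; congr (_ ^ _).
  by rewrite (mulgA (rho n a)) rho_braid // !mulgA rho_sq mul1g.
have S a b :=
  @conj_fam_swap _ (rho n) (s n) n.-1 sq_i rho_far rho_braid
    s_rho_far s_rho_adj a b i.
have T a b :=
  @conj_fam_swap _ (rho n) t n.-1 sq_i rho_far rho_braid t_far t_adj a b i.
(* Only the pairs (i, i+1) and (i+1, i) have their order reversed by the transposition; conjugation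
   by rho_i exchanges s_i and rho_i s_i rho_i. For every other pair both sides lie in the same
   family. *)
have [/andP[/eqP-> /eqP->]|ne1] := boolP ((k == i) && (l == i.+1)).
  rewrite ltnSn /adj_swap eqxx ltnNge.
  have -> : (i.+1 == i) = false by lia.
  by rewrite eqxx leqnSn /= !conj_fam_base.
have [/andP[/eqP-> /eqP->]|ne2] := boolP ((l == i) && (k == i.+1)).
  rewrite ltnNge leqnSn /adj_swap !eqxx.
  have -> : (i.+1 == i) = false by lia.
  by rewrite ltnSn /= !conj_fam_base conjgKr.
have -> : (adj_swap i k < adj_swap i l) = (k < l).
  move: ne1 ne2; rewrite /adj_swap.
  by case: (eqVneq k i); case: (eqVneq k i.+1); case: (eqVneq l i);
    case: (eqVneq l i.+1); lia.
case: ltnP => kl'; first by apply: S => //; lia.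
by apply: T => //; lia.
Qed.

End FVB.

(** * Words in the rho_i and the symmetric group *)

Section RhoWords.
Variable n : nat.

Definition rho_prod (w : seq nat) : FVB n := \prod_(i <- w) rho n i.

(** The product rho_{m-1} ... rho_j. For j <= m its permutation takes m to j, so these are coset
    representatives of S_m in S_{m+1}; j = m gives 1. *)
Definition rho_desc j m := rho_prod (rev (index_iota j m)).

Lemma rho_prod_cons i w : rho_prod (i :: w) = rho n i * rho_prod w.
Proof. exact: big_cons. Qed.

Lemma rho_prod_cat u v : rho_prod (u ++ v) = rho_prod u * rho_prod v.
Proof. exact: big_cat. Qed.

Lemma rho_prod_rcons w i : rho_prod (rcons w i) = rho_prod w * rho n i.
Proof. by rewrite -cats1 rho_prod_cat {2}/rho_prod big_seq1. Qed.

Lemma rho_prod_nil : rho_prod [::] = 1.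
Proof. exact: big_nil. Qed.

Lemma rev_iotaS j m :
  j <= m -> rev (index_iota j m.+1) = m :: rev (index_iota j m).
Proof.
by move=> jm; rewrite /index_iota subSn // -addn1 iotaD rev_cat subnKC.
Qed.

Lemma rho_desc_out j m : m <= j -> rho_desc j m = 1.
Proof.
by rewrite /rho_desc /index_iota -subn_eq0 => /eqP->; exact: rho_prod_nil.
Qed.

Lemma rho_descS j m : j <= m -> rho_desc j m.+1 = rho n m * rho_desc j m.
Proof. by move=> jm; rewrite /rho_desc rev_iotaS // rho_prod_cons. Qed.

Lemma rho_descSr j m : j < m -> rho_desc j m = rho_desc j.+1 m * rho n j.
Proof.
move=> jm; rewrite /rho_desc /index_iota -(subnSK jm) /= rev_cons.
exact: rho_prod_rcons.
Qed.

Lemma rho_prod_far w i :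
  all (fun k => far k i) w -> commute (rho_prod w) (rho n i).
Proof.
elim: w => [_|k w IH /= /andP[ki /IH wi]].
  by rewrite rho_prod_nil; exact/commute_sym/commute1.
by rewrite rho_prod_cons; apply/commute_sym/commuteM;
  apply/commute_sym => //; exact: rho_far.
Qed.

Lemma rho_desc_far j m i :
  (i.+1 < j) || (m < i) -> commute (rho_desc j m) (rho n i).
Proof.
move=> ijm; apply: rho_prod_far; apply/allP => k.
by rewrite mem_rev mem_index_iota /far; lia.
Qed.

(** Moving left, rho_{i+1} commutes with the factors below rho_i, becomes rho_i by the braid
    relation at rho_{i+1} rho_i, and commutes with the rest. *)
Lemma rho_desc_shift j i m : j <= i -> i.+1 < m -> m <= n.-1 ->
  rho_desc j m * rho n i.+1 = rho n i * rho_desc j m.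
Proof.
move=> ji; elim: m => // m IH; rewrite ltnS leq_eqVlt => /predU1P[<-|im] mn.
  rewrite !rho_descS //; last exact: leqW.
  rewrite -!mulgA (rho_desc_far (i := i.+1)) ?leqnn ?orbT //.
  by rewrite !mulgA rho_braid.
rewrite rho_descS; last lia.
rewrite -mulgA IH //; last exact: ltnW.
by rewrite !mulgA (@rho_far n m i) // /far; lia.
Qed.

(* The Coxeter normal form of the symmetric group: peel off a coset
   representative of S_{m+1} in S_{m+2}. *)
Lemma rho_normal_form m w : m < n.-1 -> all (fun i => i <= m) w ->
  exists w' j, [/\ j <= m.+1, all (fun i => i < m) w'
    & rho_prod w = rho_prod w' * rho_desc j m.+1].
Proof.
move=> mn; elim/last_ind: w => [_|w i IH].
  by exists [::], m.+1; rewrite rho_desc_out // mulg1.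
rewrite all_rcons => /andP[im /IH[w' [j [jm w'm wE]]]].
rewrite rho_prod_rcons wE -mulgA.
(* Appending rho_i to rho_m ... rho_j extends the run if j = i+1, commutes past it if j > i+1,
   cancels its last letter if j = i, and passes through as rho_{i-1} if j < i. *)
have [ij|ji] := ltnP i j.
  have [jE|ij'] : j = i.+1 \/ i.+1 < j by lia.
    exists w', i; split => //; first exact: leqW.
    by rewrite (rho_descSr (j := i)) // -jE.
  exists (rcons w' i), j; split => //;
    first by rewrite all_rcons w'm andbT; lia.
  by rewrite rho_prod_rcons rho_desc_far ?ij' // mulgA.
have [jE|ji'] : j = i \/ j < i by lia.
  exists w', j.+1; split => //; first by rewrite jE.
  by rewrite rho_descSr ?jE // -(mulgA (rho_desc _ _)) rho_sq mulg1.
exists (rcons w' i.-1), j; split => //;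
    first by rewrite all_rcons w'm andbT; lia.
case: i im ji ji' => // i im ji ji'.
by rewrite rho_desc_shift // rho_prod_rcons mulgA.
Qed.

Lemma mu_rho_val i (k : 'I_n) :
  i < n.-1 -> mu (rho n i) k = adj_swap i k :> nat.
Proof.
move=> ni; rewrite -[i in LHS]/(val (Ordinal ni)) mu_rho /adj_tperm /adj_swap.
by case: tpermP => [->|->|/eqP + /eqP]; rewrite -?val_eqE /= ?eqxx //;
  [rewrite gtn_eqF | move=> /negbTE-> /negbTE->].
Qed.

Lemma mu_rho_prod w (k : 'I_n) : all (fun i => i < n.-1) w ->
  mu (rho_prod w) k = foldl (fun a i => adj_swap i a) k w :> nat.
Proof.
elim: w k => [|i w IH] k /=; first by rewrite rho_prod_nil gmulf1 perm1.
case/andP=> ni wn; rewrite rho_prod_cons gmulfM /= permM IH //.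
by rewrite mu_rho_val.
Qed.

Lemma adj_swap_word_fix k w :
  all (fun i => i.+1 < k) w -> foldl (fun a i => adj_swap i a) k w = k.
Proof.
elim: w => //= i w IH /andP[ik /IH wk].
by rewrite {2}/adj_swap gtn_eqF 1?ltnW // gtn_eqF.
Qed.

Lemma adj_swap_desc j m : j <= m ->
  foldl (fun a i => adj_swap i a) m (rev (index_iota j m)) = j.
Proof.
elim: m => [|m IH]; first by rewrite leqn0 => /eqP->.
rewrite leq_eqVlt => /predU1P[->|jm]; first by rewrite /index_iota subnn.
rewrite rev_iotaS //= /adj_swap gtn_eqF // eqxx; exact: IH.
Qed.

Lemma rho_prod_faithful w :
  all (fun i => i < n.-1) w -> mu (rho_prod w) = 1 -> rho_prod w = 1.
Proof.
suff gen m : m <= n.-1 -> forall w, all (fun i => i < m) w ->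
    mu (rho_prod w) = 1 -> rho_prod w = 1 by exact: gen.
elim: m => [_ [|//] _ _|m IH mn {}w wm mu1]; first exact: rho_prod_nil.
have [w' [j [jm w'm wE]]] := rho_normal_form mn wm.
have mn' : m.+1 < n by lia.
have cn : all (fun i => i < n.-1) (rev (index_iota j m.+1)).
  by apply/allP => i; rewrite mem_rev mem_index_iota; lia.
have w'n : all (fun i => i < n.-1) w' by apply: sub_all w'm => i; lia.
(* Follow strand m+1: [w'] fixes it and the descending factor sends it to [j], while the whole
   permutation is trivial. *)
have jE : j = m.+1.
  have := mu_rho_prod (Ordinal mn') (w := w' ++ rev (index_iota j m.+1)).
  rewrite all_cat w'n cn rho_prod_cat -[rho_prod (rev _)]/(rho_desc _ _) -wE.
  rewrite mu1 perm1 foldl_cat (adj_swap_word_fix (w := w')) //.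
  by rewrite adj_swap_desc // => /(_ isT) <-.
move: wE mu1; rewrite jE rho_desc_out // mulg1 => ->.
exact: IH (ltnW mn) _ w'm.
Qed.

Lemma mu_rho_prod_surj (p : 'S_n) :
  exists2 w, all (fun i => i < n.-1) w & mu (rho_prod w) = p.
Proof.
pose Q (q : 'S_n) := exists2 w, all (fun i => i < n.-1) w & mu (rho_prod w) = q.
have QM q q' : Q q -> Q q' -> Q (q * q').
  move=> [w wn <-] [w' wn' <-]; exists (w ++ w'); first by rewrite all_cat wn.
  by rewrite rho_prod_cat gmulfM.
(* Induction on the distance: (a, b) is the conjugate of (a, b-1) by the adjacent transposition
   (b-1, b). *)
have Qadj d (a b : 'I_n) : b = (a + d).+1 :> nat -> Q (tperm a b).
  elim: d b => [|d IH] b ab.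
    have an : a < n.-1 by have := ltn_ord b; lia.
    exists [:: (a : nat)]; first by rewrite /= an.
    rewrite /rho_prod big_seq1 -[nat_of_ord a]/(val (Ordinal an)) mu_rho.
    by congr tperm; apply: val_inj => //=; rewrite ab addn0.
  have bn : b.-1 < n by have := ltn_ord b; lia.
  have cb : b = (Ordinal bn).+1 :> nat by rewrite /= ab.
  have acE : Ordinal bn = (a + d).+1 :> nat by rewrite /= ab addnS.
  have Qc := IH _ acE.
  have Qb : Q (tperm (Ordinal bn) b).
    have cn : Ordinal bn < n.-1 by have := ltn_ord b; lia.
    exists [:: (Ordinal bn : nat)]; first by rewrite /= cn.
    rewrite /rho_prod big_seq1 -[nat_of_ord _]/(val (Ordinal cn)) mu_rho.
    by congr tperm; apply: val_inj => //=; rewrite cb.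
  have -> : tperm a b = tperm a (Ordinal bn) ^ tperm (Ordinal bn) b.
    rewrite tpermJ tpermL tpermD // -val_eqE; move: acE cb => /=; lia.
  by rewrite conjgE tpermV; apply: (QM) => //; apply: (QM).
have Qt (a b : 'I_n) : a != b -> Q (tperm a b).
  move=> ab; wlog: a b ab / a < b => [wl|lt].
    have [|ba|/val_inj abE] := ltngtP a b; first exact: wl.
      by rewrite tpermC; apply: wl; rewrite // eq_sym.
    by rewrite abE eqxx in ab.
  by apply: (Qadj (b - a.+1)); lia.
have [ts -> tsd] := prod_tpermP p; rewrite -/(Q _).
elim: ts tsd => [_|t ts IH /= /andP[td /IH Qts]].
  by exists [::]; rewrite // big_nil rho_prod_nil gmulf1.
by rewrite big_cons; apply: QM => //; exact: Qt.
Qed.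

Lemma y_elt_rho_prod w (k l : 'I_n) : all (fun i => i < n.-1) w -> k != l ->
  y_elt n k l ^ rho_prod w = y_elt n (mu (rho_prod w) k) (mu (rho_prod w) l).
Proof.
elim: w k l => [|i w IH] k l /=.
  by rewrite rho_prod_nil gmulf1 conjg1 !perm1.
case/andP=> ni wn kl; rewrite rho_prod_cons conjgM y_elt_swap //.
by rewrite gmulfM /= !permM -IH ?(inj_eq perm_inj) // !mu_rho_val.
Qed.

End RhoWords.

Lemma perm_of_uniq (T : finType) (u v : seq T) :
  uniq u -> uniq v -> size u = size v -> exists p : {perm T}, map p u = v.
Proof.
elim: u v => [|x u IH] [|z v] //=; first by exists 1.
case/andP=> xu uu /andP[zv uv] [suv]; have [p pE] := IH v uu uv suv.
(* The permutation for the tails is corrected at [x] by a transposition that moves none of the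
   values in [v]. *)
exists (p * tperm (p x) z); rewrite permM tpermL; congr cons.
rewrite -pE; apply/eq_in_map => t tu; rewrite permM tpermD //.
  by rewrite (inj_eq perm_inj); apply: contraNneq xu => ->.
by apply: contraNneq zv => ->; rewrite -pE map_f.
Qed.

(** * Homomorphisms out of presented groups and change of relations *)

Section PresentedHom.
Variables (X : choiceType) (R : relations X).

Lemma pres_inv_gen x : (pres_gen R x)^-1 = pres_class R [:: (x, true)].
Proof. exact: pres_invE. Qed.

Lemma pres_ind (P : presented R -> Prop) : P 1 ->
  (forall g x, P x -> P (x * pres_gen R g)) ->
  (forall g x, P x -> P (x * (pres_gen R g)^-1)) -> forall x, P x.
Proof.
move=> P1 Pg PgV x; rewrite -[x]pres_classK.
elim/last_ind: (pres_repr x) => [|w [g b] IH]; first exact: P1.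
rewrite -cats1 pres_class_cat; case: b; last exact: Pg.
by rewrite -pres_inv_gen; exact: PgV.
Qed.

Lemma pres_hom_ext (G : groupType) (f g : presented R -> G) :
  {morph f : x y / x * y} -> {morph g : x y / x * y} ->
  (forall x, f (pres_gen R x) = g (pres_gen R x)) -> f =1 g.
Proof.
move=> fM gM fg.
have h1 (h : presented R -> G) : {morph h : x y / x * y} -> h 1 = 1.
  by move=> hM; apply: (@mulgI _ (h 1)); rewrite -hM !mulg1.
apply: pres_ind => [|x a fga|x a fga]; first by rewrite !h1.
  by rewrite fM gM fga fg.
apply: (@mulIg _ (f (pres_gen R x))).
by rewrite {2}fg -fM -gM !mulgVK.
Qed.

End PresentedHom.

(** When each set of relations holds in the group presented by the other, the identity on generators
    induces mutually inverse homomorphisms. *)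
Lemma has_presentation_eq (X : choiceType) (G : groupType) (f : X -> G)
    (R S : relations X) :
  (forall u v, R u v -> pres_class S u = pres_class S v) ->
  (forall u v, S u v -> pres_class R u = pres_class R v) ->
  has_presentation f R -> has_presentation f S.
Proof.
move=> RS SR [phi [phi_bij phiE]].
have ev (Q : relations X) w : word_eval (pres_gen Q) w = pres_class Q w.
  elim: w => [|[x b] w IH]; first by rewrite /word_eval big_nil.
  rewrite /word_eval big_cons -/(word_eval _ w) IH -cat1s pres_class_cat.
  by case: b => //; rewrite pres_inv_gen.
have SR' u v : S u v -> word_eval (pres_gen R) u = word_eval (pres_gen R) v.
  by rewrite !ev; exact: SR.
have RS' u v : R u v -> word_eval (pres_gen S) u = word_eval (pres_gen S) v.
  by rewrite !ev; exact: RS.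
pose h := pres_lift (R := S) (pres_gen R).
pose k := pres_lift (R := R) (pres_gen S).
have hM : {morph h : x y / x * y} := pres_liftM SR'.
have kM : {morph k : x y / x * y} := pres_liftM RS'.
have hK : cancel h k.
  apply: (@pres_hom_ext _ _ _ (k \o h) id) => [x y|//|x] /=.
    by rewrite hM kM.
  by rewrite /h pres_lift_gen // /k pres_lift_gen.
have kK : cancel k h.
  apply: (@pres_hom_ext _ _ _ (h \o k) id) => [x y|//|x] /=.
    by rewrite kM hM.
  by rewrite /k pres_lift_gen // /h pres_lift_gen.
have phM : {morph (phi \o h) : x y / x * y} by move=> x y /=; rewrite hM gmulfM.
exists (HB.pack_for {multiplicative presented S -> G} (phi \o h)
  (isMultiplicative.Build _ _ (phi \o h) phM)); split => [|x] /=.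
  by apply: bij_comp phi_bij _; exists k.
by rewrite /h pres_lift_gen // phiE.
Qed.

(** * Semidirect products for a right action *)

Section SemidirectProduct.
Variables (P A : groupType) (to : P -> A -> A).
Hypotheses (toM : forall p, {morph to p : a b / a * b})
  (to1 : to 1 =1 id) (to_mul : forall p q, to (p * q) =1 to q \o to p).

(* The three proofs are arguments so that the group structure below can be
   declared on the type. *)
Definition semidirect of (forall p, {morph to p : a b / a * b})
  & to 1 =1 id & (forall p q, to (p * q) =1 to q \o to p) : Type :=
  (P * A)%type.

Local Notation sdp := (semidirect toM to1 to_mul).

HB.instance Definition _ := Choice.on sdp.

Definition sdp_one : sdp := (1, 1).
(** The pair (p, a) stands for p followed by a, and a q = q ([to q a]). A right action suits the
    left-to-right product of ['S_n]. *)
Definition sdp_mul (x y : sdp) : sdp := (x.1 * y.1, to y.1 x.2 * y.2).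
Definition sdp_inv (x : sdp) : sdp := (x.1^-1, to x.1^-1 x.2^-1).

Lemma sdp_to1 p : to p 1 = 1.
Proof. by apply: (@mulgI _ (to p 1)); rewrite -toM !mulg1. Qed.

Lemma sdp_mulA : associative sdp_mul.
Proof. by move=> x y z; rewrite /sdp_mul /= toM to_mul /= !mulgA. Qed.

Lemma sdp_mul1 : left_id sdp_one sdp_mul.
Proof. by case=> p a; rewrite /sdp_mul /= sdp_to1 !mul1g. Qed.

Lemma sdp_mulr1 : right_id sdp_one sdp_mul.
Proof. by case=> p a; rewrite /sdp_mul /= to1 !mulg1. Qed.

Lemma sdp_mulVr : left_inverse sdp_one sdp_inv sdp_mul.
Proof.
case=> p a; rewrite /sdp_mul /sdp_inv /=.
by rewrite -[to p _]/((to p \o to p^-1) a^-1) -to_mul !mulVg to1 mulVg.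
Qed.

Lemma sdp_mulrV : right_inverse sdp_one sdp_inv sdp_mul.
Proof. by case=> p a; rewrite /sdp_mul /sdp_inv /= -toM !mulgV sdp_to1. Qed.

HB.instance Definition _ :=
  isGroup.Build sdp sdp_mulA sdp_mul1 sdp_mulr1 sdp_mulVr sdp_mulrV.

Definition sdp_inj (a : A) : sdp := (1, a).
Definition sdp_sec (p : P) : sdp := (p, 1).

Lemma sdp_injM : {morph sdp_inj : a b / a * b}.
Proof. by move=> a b; rewrite [RHS]/(sdp_mul _ _) /sdp_mul /= to1 mulg1. Qed.

Lemma sdp_secM : {morph sdp_sec : p q / p * q}.
Proof.
by move=> p q; rewrite [RHS]/(sdp_mul _ _) /sdp_mul /= sdp_to1 mulg1.
Qed.

Lemma sdp_injJ a p : sdp_inj a * sdp_sec p = sdp_sec p * sdp_inj (to p a).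
Proof.
rewrite [LHS]/(sdp_mul _ _) [RHS]/(sdp_mul _ _) /sdp_mul /=.
by rewrite sdp_to1 !mulg1 !mul1g.
Qed.

End SemidirectProduct.

(** * The action of S_n on the presented group A and the map FVB_n -> S_n |x A *)

Section FlatPure.
Variable n : nat.

Local Notation FHpres := (presented (@FH_rel n)).
Local Notation gen := (pres_gen (@FH_rel n)).

Lemma gen_sq x : gen x * gen x = 1.
Proof.
case: x => [[k l] kl].
by have /pres_class_rel := FH_sq kl; rewrite pres_class_cat.
Qed.

Lemma gen_comm (x y : FH_gen n) :
  uniq [:: (val x).1; (val x).2; (val y).1; (val y).2] ->
  commute (gen x) (gen y).
Proof.
case: x y => [[i j] ij] [[k l] kl] /= u.
by have /pres_class_rel := FH_comm ij kl u; rewrite !pres_class_cat.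
Qed.

Lemma gen_braid (x y : FH_gen n) :
  (val x).2 = (val y).1 -> uniq [:: (val x).1; (val y).2; (val x).2] ->
  gen x * gen y * gen x = gen y * gen x * gen y.
Proof.
case: x y => [[i k] ik] [[k' j] kj] /= kk'; move: kj; rewrite -kk' => kj u.
by have /pres_class_rel := FH_braid ik kj u; rewrite !pres_class_cat !mulgA.
Qed.

Lemma FH_perm_proof (p : 'S_n) (x : FH_gen n) :
  p (val x).1 != p (val x).2.
Proof. by rewrite (inj_eq perm_inj) (valP x). Qed.

Definition FH_perm (p : 'S_n) (x : FH_gen n) : FH_gen n :=
  exist _ (p (val x).1, p (val x).2) (FH_perm_proof p x).

Definition FH_act (p : 'S_n) : FHpres -> FHpres :=
  pres_lift (fun x => gen (FH_perm p x)).

(** Permutations preserve distinctness of indices, so each relation goes to a relation of the same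
    kind. *)
Lemma FH_act_rel p u v : FH_rel u v ->
  word_eval (fun x => gen (FH_perm p x)) u
  = word_eval (fun x => gen (FH_perm p x)) v.
Proof.
case=> {u v} [k l kl|i j k l ij kl u|i j k ik kj u];
  rewrite !word_eval_cat !word_eval_letter ?mulgA.
- by rewrite gen_sq /word_eval big_nil.
- by apply: gen_comm; rewrite -(map_inj_uniq (@perm_inj _ p)) in u.
- apply: gen_braid => //=.
  by rewrite -(map_inj_uniq (@perm_inj _ p)) in u.
Qed.

Lemma FH_actM p : {morph FH_act p : a b / a * b}.
Proof. exact: pres_liftM (FH_act_rel p). Qed.

Lemma FH_act_gen p x : FH_act p (gen x) = gen (FH_perm p x).
Proof. exact: pres_lift_gen (FH_act_rel p) x. Qed.

Lemma FH_act1 : FH_act 1 =1 id.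
Proof.
apply: pres_hom_ext => [|//|x]; first exact: FH_actM.
rewrite FH_act_gen; congr gen; apply: val_inj.
by rewrite /= !perm1; case: (val x).
Qed.

Lemma FH_act_mul p q : FH_act (p * q) =1 FH_act q \o FH_act p.
Proof.
apply: pres_hom_ext => [|a b|x]; first exact: FH_actM.
  by rewrite /= !FH_actM.
by rewrite /= !FH_act_gen; congr gen; apply: val_inj; rewrite /= !permM.
Qed.

Local Notation SFH := (semidirect FH_actM FH_act1 FH_act_mul).
Local Notation inj := (sdp_inj FH_actM FH_act1 FH_act_mul).
Local Notation sec := (sdp_sec FH_actM FH_act1 FH_act_mul).

Lemma adj_tperm_val i (k : 'I_n) : adj_tperm i k = adj_swap i k :> nat.
Proof. by rewrite -mu_rho mu_rho_val. Qed.

Lemma adj_gen_proof (i : 'I_n.-1) :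
  Ordinal (strand_proof i) != Ordinal (next_strand_proof i).
Proof. by rewrite -val_eqE /= neq_ltn ltnSn. Qed.

Definition adj_gen (i : 'I_n.-1) : FH_gen n :=
  exist _ (Ordinal (strand_proof i), Ordinal (next_strand_proof i))
    (adj_gen_proof i).

Definition split_gen (x : VB_gen n) : SFH :=
  match x with inl i => inj (gen (adj_gen i)) | inr i => sec (adj_tperm i) end.

Lemma FH_gen_eq (x y : FH_gen n) :
  (val x).1 = (val y).1 :> nat -> (val x).2 = (val y).2 :> nat -> x = y.
Proof.
case: x y => [[i j] ij] [[k l] kl] /= /val_inj e1 /val_inj e2.
by apply: val_inj; rewrite /= e1 e2.
Qed.

(** (R1), (R2) and s_i^2 = 1 become relations of A, (R3) to (R5) hold because [mu_gen] respects
    them, and (R6) and (M) describe how adjacent transpositions act on the y_{i,i+1}. *)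
Lemma split_gen_rel u v :
  FVB_rel u v -> word_eval split_gen u = word_eval split_gen v.
Proof.
have E0 : word_eval split_gen [::] = 1 by rewrite /word_eval big_nil.
have mu0 : word_eval (@mu_gen n) [::] = 1 by rewrite /word_eval big_nil.
case=> {u v} [u v|i]; last first.
  rewrite word_eval_cat !word_eval_letter E0 /=.
  by rewrite -sdp_injM gen_sq.
case=> {u v} [i j ij|i j ij|i j ij|i j ij|i|i j ij|i j ij];
  rewrite ?word_eval_cat !word_eval_letter ?E0 /= ?mulgA.
- rewrite -!sdp_injM gen_braid //=; first by apply: val_inj.
  by rewrite /= !inE -!val_eqE /=; lia.
- rewrite -!sdp_injM gen_comm //= !inE -!val_eqE /=.
  by move: ij; rewrite /far; lia.
- have := mu_gen_rel (FVB_VB (VB_R3 ij)).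
  by rewrite ?word_eval_cat !word_eval_letter !mulgA -!sdp_secM => ->.
- have := mu_gen_rel (FVB_VB (VB_R4 ij)).
  by rewrite ?word_eval_cat !word_eval_letter -!sdp_secM => ->.
- have := mu_gen_rel (FVB_VB (VB_R5 i)).
  by rewrite ?word_eval_cat !word_eval_letter mu0 -!sdp_secM => ->.
- rewrite sdp_injJ FH_act_gen; congr (_ * inj (gen _)).
  by apply: FH_gen_eq; rewrite /= adj_tperm_val adj_swapD //=;
    move: ij; rewrite /far; lia.
(* For (M), carrying y_{j,j+1} past the transpositions at i and then j = i+1 turns it into
   y_{i,i+1}. *)
- rewrite sdp_injJ -!mulgA sdp_injJ !FH_act_gen !mulgA.
  congr (_ * inj (gen _)); apply: FH_gen_eq; rewrite /= !adj_tperm_val /= ij.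
    by rewrite adj_swapR adj_swapD //; lia.
  by rewrite (@adj_swapD i) ?adj_swapR //; lia.
Qed.

Definition FVB_split : FVB n -> SFH := pres_lift split_gen.

Lemma FVB_splitM : {morph FVB_split : x y / x * y}.
Proof. exact: pres_liftM split_gen_rel. Qed.

Lemma FVB_split_gen x : FVB_split (pres_gen _ x) = split_gen x.
Proof. exact: pres_lift_gen split_gen_rel x. Qed.

Lemma FVB_split_rho_prod w : all (fun i => i < n.-1) w ->
  FVB_split (rho_prod n w) = sec (mu (rho_prod n w)).
Proof.
elim: w => [_|i w IH /= /andP[ni wn]].
  by rewrite rho_prod_nil gmulf1; exact: pres_lift1 split_gen_rel.
rewrite rho_prod_cons FVB_splitM IH // gmulfM /= sdp_secM; congr (_ * _).
by rewrite -[i]/(val (Ordinal ni)) mu_rho rhoE FVB_split_gen.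
Qed.

(** * Relations between the y_{k,l} in FVB_n *)

Lemma y_elt_adj i : y_elt n i i.+1 = s n i.
Proof. by rewrite y_eltE ltnSn conj_fam_base. Qed.

(** Reduces a relation on arbitrary distinct strands, by conjugation with a word in the rho_i, to
    strands 0, 1, 2, ..., where y_{i,i+1} = s_i. *)
Lemma standard_position (u : seq 'I_n) : uniq u ->
  exists w v, [/\ all (fun i => i < n.-1) w, map val v = iota 0 (size u)
    & map (mu (rho_prod n w)) v = u].
Proof.
move=> uu; have un : size u <= n.
  by rewrite -(card_uniqP uu) -[X in _ <= X]card_ord max_card.
pose v := take (size u) (enum 'I_n).
have vE : map val v = iota 0 (size u).
  by rewrite map_take val_enum_ord take_iota; congr iota; exact/minn_idPl.
have [||p pE] := @perm_of_uniq _ v u _ uu.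
- by rewrite take_uniq // enum_uniq.
- by rewrite -(size_map val) vE size_iota.
by have [w wn wE] := mu_rho_prod_surj p; exists w, v; rewrite wE.
Qed.

Lemma y_elt_sq (k l : 'I_n) : k != l -> y_elt n k l * y_elt n k l = 1.
Proof.
move=> kl; have [|w [v []]] := @standard_position [:: k; l].
  by rewrite /= inE kl.
case: v => [|a [|b [|? ?]]] // wn [a0 b1] [<- <-].
rewrite -y_elt_rho_prod -?val_eqE /= ?a0 ?b1 // -conjMg y_elt_adj s_sq.
exact: conj1g.
Qed.

Lemma y_elt_comm (i j k l : 'I_n) : uniq [:: i; j; k; l] ->
  commute (y_elt n i j) (y_elt n k l).
Proof.
move=> /standard_position [w [v []]].
case: v => [|a [|b [|c [|d [|? ?]]]]] // wn [a0 b1 c2 d3] [<- <- <- <-].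
(* A strand with value 3 forces n > 3, so s_0 and s_2 have indices within range. *)
have dn := ltn_ord d; rewrite d3 in dn.
rewrite -!y_elt_rho_prod -?val_eqE /= ?a0 ?b1 ?c2 ?d3 //.
rewrite /commute -!conjMg !y_elt_adj s_far // /far; lia.
Qed.

Lemma y_elt_braid (i j k : 'I_n) : uniq [:: i; j; k] ->
  y_elt n i j * y_elt n j k * y_elt n i j
  = y_elt n j k * y_elt n i j * y_elt n j k.
Proof.
move=> /standard_position [w [v []]].
case: v => [|a [|b [|c [|? ?]]]] // wn [a0 b1 c2] [<- <- <-].
have cn := ltn_ord c; rewrite c2 in cn.
rewrite -!y_elt_rho_prod -?val_eqE /= ?a0 ?b1 ?c2 //.
rewrite -!conjMg !y_elt_adj s_braid //; lia.
Qed.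

Lemma FVB_split_y (x : FH_gen n) : FVB_split (val (y x)) = inj (gen x).
Proof.
case: x => [[k l] kl] /=.
have [|w [v []]] := @standard_position [:: k; l]; first by rewrite /= inE andbT.
case: v => [|a [|b [|? ?]]] // wn [a0 b1] [kE lE].
have bn := ltn_ord b; rewrite b1 in bn.
have an : 0 < n.-1 by lia.
have abE : exist _ (k, l) kl
    = FH_perm (mu (rho_prod n w)) (adj_gen (Ordinal an)).
  apply: val_inj; rewrite /= -kE -lE.
  by congr (mu _ _, mu _ _); apply: val_inj.
have yE : s n 0 ^ rho_prod n w = y_elt n k l.
  rewrite -y_elt_adj -kE -lE -y_elt_rho_prod ?a0 ?b1 // -val_eqE /=.
  by rewrite a0 b1.
(* Multiplying by the permutation turns the conjugation into rho_w y_{k,l} = s_0 rho_w, whose image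
   is the commutation rule [sdp_injJ]. *)
apply: (@mulgI _ (sec (mu (rho_prod n w)))).
rewrite -FVB_split_rho_prod // -FVB_splitM -yE -conjgC FVB_splitM.
rewrite FVB_split_rho_prod // abE -FH_act_gen -sdp_injJ; congr (_ * _).
by rewrite -[0%N]/(val (Ordinal an)) sE FVB_split_gen.
Qed.

(** * Bijectivity of A -> FH_n *)

Definition y_hom : FHpres -> FH n := pres_lift (@y n).

Lemma y_rel u v : FH_rel u v -> word_eval (@y n) u = word_eval (@y n) v.
Proof.
case=> {u v} [k l kl|i j k l ij kl ijkl|i j k ik kj ijk];
  rewrite !word_eval_cat !word_eval_letter ?mulgA; apply: val_inj;
  rewrite !gmulfM /=.
- by rewrite y_elt_sq // /word_eval big_nil.
- exact: y_elt_comm.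
- apply: y_elt_braid; rewrite (@perm_uniq _ _ [:: i; j; k]) // perm_cons.
  exact: permEl (perm_catC [:: k] [:: j]).
Qed.

Lemma y_homM : {morph y_hom : a b / a * b}.
Proof. exact: pres_liftM y_rel. Qed.

Lemma y_hom_gen x : y_hom (gen x) = y x.
Proof. exact: pres_lift_gen y_rel x. Qed.

Lemma FVB_split_y_hom a : FVB_split (val (y_hom a)) = inj a.
Proof.
move: a; apply: pres_hom_ext => [a b|a b|x].
- by rewrite y_homM gmulfM /= FVB_splitM.
- exact: sdp_injM.
- by rewrite y_hom_gen FVB_split_y.
Qed.

Lemma y_homJ (i : 'I_n.-1) a :
  val (y_hom a) ^ rho n i = val (y_hom (FH_act (adj_tperm i) a)).
Proof.
move: a; apply: pres_hom_ext => [a b|a b|[[k l] kl]].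
- by rewrite y_homM gmulfM /= conjMg.
- by rewrite FH_actM y_homM gmulfM.
rewrite FH_act_gen !y_hom_gen /= y_elt_swap //.
by rewrite !adj_tperm_val.
Qed.

(** Build [x] letter by letter on the right: s_i is absorbed into [a], and rho_i moves left past the
    image of [a] by [y_homJ]. *)
Lemma FVB_factor (x : FVB n) : exists w a,
  all (fun i => i < n.-1) w /\ x = rho_prod n w * val (y_hom a).
Proof.
have step (g : VB_gen n) z :
    (exists w a, all (fun i => i < n.-1) w
      /\ z = rho_prod n w * val (y_hom a)) ->
    exists w a, all (fun i => i < n.-1) w
      /\ z * pres_gen (@FVB_rel n) g = rho_prod n w * val (y_hom a).
  move=> [w [a [wn ->]]]; case: g => i.
    exists w, (a * gen (adj_gen i)); split=> //.
    by rewrite y_homM gmulfM /= y_hom_gen /= y_elt_adj sE mulgA.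
  exists (rcons w i), (FH_act (adj_tperm i) a).
  rewrite all_rcons wn ltn_ord; split=> //.
  by rewrite -y_homJ rho_prod_rcons -!mulgA -conjgC rhoE.
elim/pres_ind: x => [|g z|g z].
- exists [::], 1; split=> //.
  by rewrite rho_prod_nil mul1g /y_hom (pres_lift1 y_rel) gmulf1.
- exact: step.
(* Generators of FVB_n are involutions, so inverse letters reduce to the same step. *)
have -> : (pres_gen (@FVB_rel n) g)^-1 = pres_gen (@FVB_rel n) g;
  last exact: step.
apply: mulg1_eq; case: g => i; first by have := s_sq n i; rewrite sE.
by have := rho_sq n i; rewrite rhoE.
Qed.

Lemma y_homK : cancel y_hom (fun x => (FVB_split (val x)).2).
Proof. by move=> a; rewrite FVB_split_y_hom. Qed.

Lemma y_hom_surj x : exists a, x = y_hom a.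
Proof.
have [w [a [wn xE]]] := FVB_factor (val x); exists a; apply: val_inj.
rewrite [LHS]xE rho_prod_faithful ?mul1g //.
(* Both [x] and the image of [a] lie in the kernel of [mu], so the rho-word has trivial
   permutation. *)
have /eqP := valP x; rewrite xE gmulfM /=.
by have /eqP-> := valP (y_hom a); rewrite mulg1.
Qed.

Lemma FH_presentation : has_presentation (@y n) (@FH_rel n).
Proof.
exists (HB.pack_for {multiplicative FHpres -> FH n} y_hom
  (isMultiplicative.Build _ _ y_hom y_homM)); split; last exact: y_hom_gen.
exists (fun x => (FVB_split (val x)).2); first exact: y_homK.
by move=> x; have [a ->] := y_hom_surj x; rewrite /= y_homK.
Qed.

End FlatPure.

(** * Equivalence of the two forms of the relations *)

Lemma involution_commute_iff (G : groupType) (a b : G) :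
  a ^+ 2 = 1 -> b ^+ 2 = 1 -> a * b = b * a <-> (a * b) ^+ 2 = 1.
Proof.
rewrite !expg2 => a2 b2.
(* For involutions (ab)^-1 = ba, so commuting means that ab is its own inverse. *)
split=> [E|/mulg1_eq]; first by rewrite {2}E mulgA -(mulgA a) b2 mulg1.
by rewrite invgM (mulg1_eq a2) (mulg1_eq b2).
Qed.

(** (ab)^3 = (aba)(bab), and both factors are their own inverses. *)
Lemma involution_braid_iff (G : groupType) (a b : G) :
  a ^+ 2 = 1 -> b ^+ 2 = 1 ->
  a * b * a = b * a * b <-> (a * b) ^+ 3 = 1.
Proof.
rewrite !expg2 => /mulg1_eq aV /mulg1_eq bV.
have -> : (a * b) ^+ 3 = (a * b * a) * (b * a * b).
  by rewrite !expgSS expg1 !mulgA.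
have bab : (b * a * b)^-1 = b * a * b by rewrite !invgM aV bV mulgA.
by split=> [->|/mulg1_eq]; [rewrite -{1}bab mulVg | rewrite !invgM aV bV mulgA].
Qed.

Lemma pres_class_exp (X : choiceType) (R : relations X) w m :
  pres_class R (word_exp w m) = pres_class R w ^+ m.
Proof. by elim: m => // m IH; rewrite expgS -IH -pres_class_cat. Qed.

Theorem theorem5p3 (n : nat) (n_gt0 : (0 < n)%N) :
  [/\ has_presentation (@y n) (@FH_rel n),
      has_presentation (@y n) (@FH_cox_rel n)
    & forall (G : groupType) (a b : G), a ^+ 2 = 1 -> b ^+ 2 = 1 ->
        (a * b = b * a <-> (a * b) ^+ 2 = 1)
        /\ (a * b * a = b * a * b <-> (a * b) ^+ 3 = 1)].
Proof.
split; first exact: FH_presentation; last first.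
  by move=> G a b a2 b2; split;
    [exact: involution_commute_iff | exact: involution_braid_iff].
(* Generators square to 1 under either set of relations, so the equivalences for involutions apply
   in both presented groups. *)
have cox_sq (k l : 'I_n) (kl : k != l) :
    pres_class (@FH_cox_rel n) (yw kl) ^+ 2 = 1.
  by rewrite -pres_class_exp; exact/pres_class_rel/FH_cox_sq.
have FH_sq2 (k l : 'I_n) (kl : k != l) :
    pres_class (@FH_rel n) (yw kl) ^+ 2 = 1.
  by rewrite -pres_class_exp; exact/pres_class_rel/FH_sq.
apply: has_presentation_eq (FH_presentation n) => u v.
  case=> {u v} [k l kl|i j k l ij kl u|i j k ik kj u].
  - by have := cox_sq _ _ kl; rewrite expg2 -pres_class_cat.
  - rewrite !pres_class_cat; apply/involution_commute_iff => //.
    rewrite -pres_class_cat -pres_class_exp.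
    exact/pres_class_rel/FH_cox_comm.
  - rewrite !pres_class_cat !mulgA; apply/involution_braid_iff => //.
    rewrite -pres_class_cat -pres_class_exp.
    exact/pres_class_rel/FH_cox_braid.
case=> {u v} [k l kl|i j k l ij kl u|i j k ik kj u].
- by rewrite pres_class_exp.
- rewrite pres_class_exp pres_class_cat; apply/involution_commute_iff => //.
  by have /pres_class_rel := FH_comm ij kl u; rewrite !pres_class_cat.
- rewrite pres_class_exp pres_class_cat; apply/involution_braid_iff => //.
  by have /pres_class_rel := FH_braid ik kj u; rewrite !pres_class_cat !mulgA.
Qed.
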